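(* For any connected graph $G$ of order $n \geq 2$, $$2n + \lceil n/2 \rceil \leq \tilde{\gamma}_{c}(M(G \circ P_2)) \leq 3n.$$
   Context: All graphs are non-empty, finite, undirected and simple. The order of a graph is its number of vertices. The $2$-corona $G \circ P_2$ of a graph $G$ is the graph of order $3|V(G)|$ obtained from $G$ by attaching a path of length $2$ to each vertex of $G$ so that the resulting paths are vertex-disjoint; explicitly, if $V(G) = \{v_1,\dots,v_n\}$, then $V(G\circ P_2) = \{v_1,\dots,v_{3n}\}$ and $E(G \circ P_2) = E(G) \cup \{v_iv_{n+i},\, v_{n+i}v_{2n+i} \mid 1 \leq i \leq n\}$. A dominating set of a graph $H$ is a set $S \subseteq V(H)$ such that $N_H[v] \cap S \neq \emptyset$ for every $v \in V(H)$, where $N_H[v]$ is the closed neighborhood of $v$. A dominating set $S$ of $H$ is an outer-connected dominating set if the graph $H - S$ (obtained by deleting the vertices in $S$) is connected. The outer-connected domination number $\tilde{\gamma}_c(H)$ is the minimum cardinality of an outer-connected dominating set of $H$. The middle graph $M(G)$ of a graph $G$ is the graph with vertex set $V(G) \cup E(G)$ (disjoint union), in which two vertices $x,y$ are adjacent if and only if either $x,y \in E(G)$ are distinct edges sharing an endpoint in $G$, or one of them is a vertex of $G$ and the other is an edge of $G$ incident with it. *)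

(* Defs.v *)
From mathcomp Require Import all_boot.

Set Implicit Arguments.
Unset Strict Implicit.
Unset Printing Implicit Defensive.

Record sgraph := SGraph {
  vertex :> finType;
  adj : rel vertex;
  adj_sym : symmetric adj;
  adj_irr : irreflexive adj }.

Arguments adj {s} x y.

(* The graph with no vertices does not count as connected. *)
Definition connected (G : sgraph) : bool :=
  (0 < #|G|) && [forall x : G, forall y : G, connect adj x y].

Definition edges (G : sgraph) : {set {set G}} :=
  [set e : {set G} | [exists x, exists y, adj x y && (e == [set x; y])]].

Definition closed_neighborhood (G : sgraph) (v : G) : {set G} :=
  [set w | (w == v) || adj v w].

Section DeleteVertices.
Variables (G : sgraph) (S : {set G}).

Definition delete_adj : rel {x : G | x \notin S} :=
  fun x y => adj (val x) (val y).

Lemma delete_adj_sym : symmetric delete_adj.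
Proof. by move=> x y; rewrite /delete_adj adj_sym. Qed.

Lemma delete_adj_irr : irreflexive delete_adj.
Proof. by move=> x; rewrite /delete_adj adj_irr. Qed.

Definition delete_vertices : sgraph := SGraph delete_adj_sym delete_adj_irr.
End DeleteVertices.

Definition dominating (G : sgraph) (S : {set G}) : bool :=
  [forall v : G, closed_neighborhood v :&: S != set0].

Definition outer_connected_dominating (G : sgraph) (S : {set G}) : bool :=
  dominating S && connected (delete_vertices S).

(* The default value #|G| bounds every #|S| from above, so it does not alter
   the minimum; it is the value taken when no set S qualifies, as happens for
   the one-vertex graph. *)
Definition outer_connected_domination_number (G : sgraph) : nat :=
  \big[minn/#|G|]_(S : {set G} | outer_connected_dominating S) #|S|.

Section TwoCorona.
Variable G : sgraph.

(* With V(G) = {v_1, ..., v_n}, the pair (v_i, k) encodes v_(k n + i). *)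
Definition corona2_adj : rel (G * 'I_3)%type := fun x y =>
  [&& x.2 == 0 :> nat, y.2 == 0 :> nat & adj x.1 y.1]
  || (x.1 == y.1) && ((x.2.+1 == y.2 :> nat) || (y.2.+1 == x.2 :> nat)).

Lemma corona2_adj_sym : symmetric corona2_adj.
Proof.
move=> x y; rewrite /corona2_adj adj_sym (eq_sym x.1).
by rewrite andbCA (orbC (x.2.+1 == y.2 :> nat)).
Qed.

Lemma corona2_adj_irr : irreflexive corona2_adj.
Proof.
by move=> x; rewrite /corona2_adj adj_irr !andbF orbb gtn_eqF ?ltnSn ?andbF.
Qed.

Definition corona2 : sgraph := SGraph corona2_adj_sym corona2_adj_irr.
End TwoCorona.

Section MiddleGraph.
Variable G : sgraph.

Definition middle_adj : rel (G + {e : {set G} | e \in edges G})%type :=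
  fun x y => match x, y with
  | inl _, inl _ => false
  | inl v, inr e => v \in val e
  | inr e, inl v => v \in val e
  | inr e, inr f => (e != f) && (val e :&: val f != set0)
  end.

Lemma middle_adj_sym : symmetric middle_adj.
Proof. by case=> [v|e] [w|f] //=; rewrite eq_sym setIC. Qed.

Lemma middle_adj_irr : irreflexive middle_adj.
Proof. by case=> [v|e] //=; rewrite eqxx. Qed.

Definition middle_graph : sgraph := SGraph middle_adj_sym middle_adj_irr.
End MiddleGraph.

(* Main.v *)
Require Import Defs.
From mathcomp Require Import all_boot zify.

(** Write H for the 2-corona of G. In H the copy of a vertex v of G carries a
pendant path root v - mid v - leaf v, whose two edges are called stem v (at the
root) and twig v (at the leaf).

Upper bound. The 3n vertices of H dominate M(H), since an edge contains its
endpoints. Deleting them leaves the line graph of H, which is connected because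
H is. This works for every connected graph with at least two vertices
(outer_connected_domination_middle_le).

Lower bound. Let S be an outer-connected dominating set. Each vertex of M(H) is
given a charge of 2, spread over the vertices of G: a vertex of H gives 2 to
the vertex of G it belongs to, and an edge of H gives 1 for each endpoint. So
stems and twigs give 2 to a single vertex, and an edge uv of G gives 1 to u and
1 to v. The charges of the elements of S add up to 2|S| (sum_load), hence it is
enough to show that every v receives at least 5 from S: then 2|S| >= 5n, that
is |S| >= 2n + n/2.

The set tip v = {mid v, leaf v, twig v} is joined to the rest of M(H) only
through stem v. As the complement of S is connected, stem v in S forces either
tip v to lie in S, so that v receives at least 6, or the whole complement of S
to lie in tip v. If stem v is not in S, then leaf v is in S (otherwise twig v,
its only neighbor, is in S, and leaf v is isolated in the complement of S, which
is therefore {leaf v}); dominating mid v puts mid v or twig v in S; and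
dominating root v puts in S another element that gives at least 1 to v. That
makes 2 + 2 + 1 = 5 (load_ge5).

In the exceptional case, where the complement of S lies in a single tip v, the
set S is nearly everything: 2|S| >= 6n - 2 (card_ge_tip), which is at least 5n
because n >= 2. *)

Set Implicit Arguments.
Unset Strict Implicit.
Unset Printing Implicit Defensive.

(** * Minima and sums of natural numbers *)

(** [minn] has no neutral element, so the minimum cannot be split at [i] by the
lemmas on monoid laws; the induction is on the enumeration of the index type. *)
Lemma bigminn_le (I : finType) (P : pred I) (F : I -> nat) (m : nat) (i : I) :
  P i -> \big[minn/m]_(j | P j) F j <= F i.
Proof.
move=> Pi; have := mem_index_enum i.
elim: (index_enum I) => // j s IHs; rewrite inE big_cons.
case/orP=> [/eqP<-|/IHs le_i]; first by rewrite Pi geq_minl.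
by case: ifP => // _; exact: leq_trans (geq_minr _ _) le_i.
Qed.

Lemma leq_bigminn (I : finType) (P : pred I) (F : I -> nat) (m k : nat) :
  k <= m -> (forall i, P i -> k <= F i) -> k <= \big[minn/m]_(i | P i) F i.
Proof.
by move=> km kF; elim/big_ind: _ => // x y kx ky; rewrite leq_min kx.
Qed.

Lemma leq_sum_uniq (I : finType) (s : seq I) (A : {set I}) (F : I -> nat) :
  uniq s -> {subset s <= A} -> \sum_(i <- s) F i <= \sum_(i in A) F i.
Proof.
move=> s_uniq sA; rewrite big_uniq //.
rewrite [leqRHS](bigID (mem s)) /= -[leqLHS]addn0 leq_add //.
rewrite [leqRHS](eq_bigl (mem s)) // => i /=.
by case: (boolP (i \in s)) => [/sA ->|]; rewrite ?andbF.
Qed.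

(** * Edges, connectedness and middle graphs *)

Lemma mem_edges (H : sgraph) (x y : H) : adj x y -> [set x; y] \in edges H.
Proof.
by move=> xy; rewrite inE; apply/existsP; exists x; apply/existsP; exists y;
  rewrite xy eqxx.
Qed.

Lemma edgesP (H : sgraph) (e : {set H}) :
  reflect (exists x, exists2 y, adj x y & e = [set x; y]) (e \in edges H).
Proof.
apply: (iffP idP) => [|[x [y xy ->]]]; last exact: mem_edges.
by rewrite inE => /existsP[x /existsP[y /andP[xy /eqP->]]]; exists x, y.
Qed.

Lemma card_edge (H : sgraph) (e : {set H}) : e \in edges H -> #|e| = 2.
Proof.
case/edgesP => x [y xy ->]; rewrite cards2.
by case: eqP xy => // ->; rewrite adj_irr.
Qed.

Lemma edge_at (H : sgraph) (e : {set H}) (x : H) :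
  e \in edges H -> x \in e -> exists2 y, adj x y & e = [set x; y].
Proof.
case/edgesP=> y [z yz ->]; rewrite !inE => /orP[]/eqP->; first by exists z.
by exists y; rewrite ?(adj_sym z) // setUC.
Qed.

Local Notation edge H := {e : {set vertex H} | e \in edges H}.

Lemma connected_connect (H : sgraph) :
  connected H -> forall x y : H, connect adj x y.
Proof. by case/andP=> _ /forallP conn x y; apply: (forallP (conn x)). Qed.

Definition edge_vertex (H : sgraph) (x y : H) (xy : adj x y) : middle_graph H :=
  inr (Sub [set x; y] (mem_edges xy)).

(** How connectedness of the complement of [S] is exploited: a set [X] that
cannot be left without passing through [S] contains the whole complement of [S]
as soon as it meets it. *)
Lemma delete_vertices_sub (H : sgraph) (S X : {set H}) (x : H) :
  connected (delete_vertices S) -> x \in X -> x \notin S ->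
  (forall y z, y \in X -> adj y z -> z \notin S -> z \in X) ->
  ~: S \subset X.
Proof.
move=> conn xX xS Xclosed; apply/subsetP => y; rewrite inE => yS.
have := connected_connect conn (Sub x xS) (Sub y yS).
have sym : connect_sym (@delete_adj _ S) by exact/sym_connect_sym/delete_adj_sym.
have Xcl : closed (@delete_adj _ S) [pred z | val z \in X].
  apply: intro_closed => // u v uv uX.
  exact: Xclosed uX uv (valP v).
by move/(closed_connect Xcl); rewrite !inE /= xX => <-.
Qed.

Lemma dominating_vertex (H : sgraph) (S : {set middle_graph H}) (x : H) :
  dominating S -> inl x \in S \/ exists2 e, inr e \in S & x \in val e.
Proof.
move/forallP/(_ (inl x))/set0Pn => -[[y|e]]; rewrite !inE.
  by rewrite orbF => /andP[/eqP[->] xS]; left.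
by case/andP=> xe eS; right; exists e.
Qed.

(** A walk in [H] gives a walk in the line graph of [H], because consecutive
edges of the former share a vertex. The hypothesis on [S] makes the line graph
a part of what remains of the middle graph after the deletion of [S]. *)
Lemma middle_edges_connect (H : sgraph) (S : {set middle_graph H})
    (noE : forall e, inr e \notin S) (x y : H) (e f : edge H) :
  connect adj x y -> x \in val e -> y \in val f ->
  connect (@delete_adj _ S) (Sub (inr e) (noE e)) (Sub (inr f) (noE f)).
Proof.
have step (z : H) (e1 e2 : edge H) :
    z \in val e1 -> z \in val e2 ->
    connect (@delete_adj _ S) (Sub (inr e1) (noE e1)) (Sub (inr e2) (noE e2)).
  move=> ze1 ze2; have [<-|e12] := eqVneq e1 e2; first exact: connect0.
  apply: connect1; rewrite /delete_adj /= e12 /=.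
  by apply/set0Pn; exists z; rewrite inE ze1.
case/connectP => p; elim: p x e => [|z p IHp] x e /=.
  by move=> _ -> xe yf; exact: step xe yf.
case/andP => xz zp yz xe yf.
pose g : edge H := Sub [set x; z] (mem_edges xz).
apply: (@connect_trans _ _ (Sub (inr g) (noE g))).
  by apply: (step x) => //; rewrite /= !inE eqxx.
by apply: (IHp z) => //; rewrite /= !inE eqxx orbT.
Qed.

(** The witness is the set of all vertices of [H]. The bound on the order gives
an edge, and so a non-empty complement. *)
Lemma outer_connected_domination_middle_le (H : sgraph) :
  connected H -> 1 < #|H| ->
  outer_connected_domination_number (middle_graph H) <= #|H|.
Proof.
move=> connH H_gt1.
pose S : {set middle_graph H} := [set inl x | x : H].
have cardS : #|S| = #|H| by rewrite card_imset //; exact: inl_inj.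
rewrite -cardS; apply: bigminn_le; apply/andP; split.
  apply/forallP => -[x|e]; apply/set0Pn.
    by exists (inl x); rewrite !inE eqxx imset_f.
  case/edgesP: (valP e) => x [y xy exy]; exists (inl x).
  by rewrite !inE imset_f // /= [sval e]exy !inE eqxx.
have noE e : inr e \notin S by apply/negP => /imsetP[].
apply/andP; split.
  case/card_gt1P: H_gt1 => x [y [_ _ xy]].
  case/connectP: (connected_connect connH x y) => -[_ yx|z p /= /andP[xz _] _].
    by rewrite yx eqxx in xy.
  by apply/card_gt0P; exists (Sub (edge_vertex xz) (noE _)).
apply/forallP => -[[x|e] /= eS]; first by have := eS; rewrite imset_f.
apply/forallP => -[[y|f] /= fS]; first by have := fS; rewrite imset_f.
rewrite (bool_irrelevance eS (noE e)) (bool_irrelevance fS (noE f)).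
case/edgesP: (valP e) => x [x' _ ex]; case/edgesP: (valP f) => y [y' _ fy].
apply: (middle_edges_connect noE (connected_connect connH x y)).
  by rewrite ex !inE eqxx.
by rewrite fy !inE eqxx.
Qed.

(** * Structure of the 2-corona *)

Section Corona.
Variable G : sgraph.
Implicit Types (u v : G) (S : {set middle_graph (corona2 G)}).

Definition root v : corona2 G := (v, @Ordinal 3 0 isT).
Definition mid v : corona2 G := (v, @Ordinal 3 1 isT).
Definition leaf v : corona2 G := (v, @Ordinal 3 2 isT).

Lemma levels_neq v :
  ((root v == mid v) = false) * ((root v == leaf v) = false)
  * ((mid v == leaf v) = false).
Proof. by do !split; apply/eqP => -[]. Qed.

Lemma adj_root_mid v : adj (root v) (mid v).
Proof. by rewrite /= /corona2_adj /= eqxx. Qed.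

Lemma adj_mid_leaf v : adj (mid v) (leaf v).
Proof. by rewrite /= /corona2_adj /= eqxx. Qed.

Definition stem v := edge_vertex (adj_root_mid v).
Definition twig v := edge_vertex (adj_mid_leaf v).

Variant corona2_vertex_spec : corona2 G -> Type :=
  | IsRoot v : corona2_vertex_spec (root v)
  | IsMid v : corona2_vertex_spec (mid v)
  | IsLeaf v : corona2_vertex_spec (leaf v).

Lemma corona2_vertexP x : corona2_vertex_spec x.
Proof.
case: x => v [[|[|[|//]]] lt3].
- by rewrite (_ : (_, _) = root v); [constructor | congr pair; apply: val_inj].
- by rewrite (_ : (_, _) = mid v); [constructor | congr pair; apply: val_inj].
- by rewrite (_ : (_, _) = leaf v); [constructor | congr pair; apply: val_inj].
Qed.

(** Every vertex is joined to its root along the pendant path, and the roots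
form a copy of [G]. *)
Lemma connected_corona2 : connected G -> connected (corona2 G).
Proof.
move=> conn; have /andP[/card_gt0P[v0 _] _] := conn.
apply/andP; split; first by apply/card_gt0P; exists (root v0).
have sym : connect_sym (@adj (corona2 G)) by exact/sym_connect_sym/adj_sym.
have to_root x : connect (@adj (corona2 G)) (root x.1) x.
  have rm v := connect1 (adj_root_mid v).
  case: (corona2_vertexP x) => v /=; [exact: connect0 | exact: rm|].
  exact: connect_trans (rm v) (connect1 (adj_mid_leaf v)).
apply/forallP=> x; apply/forallP=> y.
apply: connect_trans (_ : connect _ x (root x.1)) _; first by rewrite sym.
apply: connect_trans (to_root y).
have /connectP[p] := connected_connect conn x.1 y.1.
elim: p (x.1) => [|z p IHp] u /=; first by move=> _ ->; exact: connect0.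
case/andP=> uz zp yz; apply: connect_trans (IHp z zp yz).
by apply: connect1; rewrite /= /corona2_adj /= uz.
Qed.

Lemma adj_mid v (x : corona2 G) : adj (mid v) x -> x = root v \/ x = leaf v.
Proof.
by case: (corona2_vertexP x) => u; rewrite /= /corona2_adj /= ?andbF ?orbF //=
  => /andP[/eqP-> _]; [left | right].
Qed.

Lemma adj_leaf v (x : corona2 G) : adj (leaf v) x -> x = mid v.
Proof.
by case: (corona2_vertexP x) => u; rewrite /= /corona2_adj /= ?andbF ?orbF //=
  => /andP[/eqP-> _].
Qed.

Lemma edge_at_mid v (e : edge (corona2 G)) :
  mid v \in val e -> inr e = stem v \/ inr e = twig v.
Proof.
case/(edge_at (valP e)) => x /adj_mid[]-> ve; [left | right];
  by congr inr; apply: val_inj; rewrite ve //= setUC.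
Qed.

Lemma edge_at_leaf v (e : edge (corona2 G)) :
  leaf v \in val e -> inr e = twig v.
Proof.
by case/(edge_at (valP e)) => x /adj_leaf-> ve; congr inr; apply: val_inj;
  rewrite ve //= setUC.
Qed.

(** * The charge that vertices of the middle graph give to G *)

Definition charge (m : middle_graph (corona2 G)) v : nat :=
  match m with
  | inl x => 2 * (x.1 == v)
  | inr e => #|[set x in val e | x.1 == v]|
  end.

(** For an edge, its two endpoints are counted according to the vertex of [G]
that they belong to. *)
Lemma sum_charge m : \sum_v charge m v = 2.
Proof.
case: m => [x|e] /=.
  rewrite (bigD1 x.1) //= eqxx big1 // => v vx.
  by rewrite eq_sym (negPf vx).
transitivity #|val e|; last exact: card_edge (valP e).
rewrite -[RHS]sum1_card.
rewrite (partition_big (fun x : corona2 G => x.1) xpredT) //=.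
by apply: eq_bigr => v _; rewrite -sum1_card; apply: eq_bigl => x; rewrite inE.
Qed.

Definition load S v := \sum_(m in S) charge m v.

Lemma sum_load S : \sum_v load S v = 2 * #|S|.
Proof.
rewrite /load exchange_big /= (eq_bigr (fun=> 2)).
  by rewrite sum_nat_const mulnC.
by move=> m _; exact: sum_charge.
Qed.

Lemma charge_vertex (x : corona2 G) : charge (inl x) x.1 = 2.
Proof. by rewrite /= eqxx. Qed.

Lemma charge_block_edge v (x y : corona2 G) (xy : adj x y) :
  x.1 = v -> y.1 = v -> charge (edge_vertex xy) v = 2.
Proof.
move=> xv yv; transitivity #|[set x; y]|; last exact: card_edge (mem_edges xy).
apply: eq_card => z; rewrite !inE.
by case: eqP => [->|_]; [rewrite xv eqxx | case: eqP => [->|//]; rewrite yv eqxx].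
Qed.

Lemma charge_root_edge v (e : edge (corona2 G)) :
  root v \in val e -> 0 < charge (inr e) v.
Proof. by move=> ve; apply/card_gt0P; exists (root v); rewrite !inE eqxx andbT. Qed.

(** * Lower bound *)

Definition tip v : {set middle_graph (corona2 G)} :=
  [set inl (mid v); inl (leaf v); twig v].

Lemma load_ge S v (s : seq (middle_graph (corona2 G))) :
  uniq s -> {subset s <= S} -> \sum_(m <- s) charge m v <= load S v.
Proof. exact: leq_sum_uniq. Qed.

Lemma load_vertices S v :
  inl (root v) \in S -> inl (mid v) \in S -> inl (leaf v) \in S -> 6 <= load S v.
Proof.
move=> rS mS lS.
have := @load_ge S v [:: inl (root v); inl (mid v); inl (leaf v)].
rewrite /= !inE /eq_op /= ?levels_neq => /(_ isT).
rewrite !big_cons big_nil /= eqxx; apply.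
by apply/allP; rewrite /= rS mS lS.
Qed.

Lemma tipP v m :
  reflect [\/ m = inl (mid v), m = inl (leaf v) | m = twig v] (m \in tip v).
Proof.
rewrite !inE -orbA.
by apply: (iffP or3P) => -[/eqP|/eqP|/eqP]; constructor.
Qed.

(** [stem v] separates [tip v] from the rest of the middle graph, since [mid v]
lies on no edge but [stem v] and [twig v], and [leaf v] on none but [twig v]. *)
Lemma tip_neighbor v (y z : middle_graph (corona2 G)) :
  y \in tip v -> adj y z -> z \in tip v \/ z = stem v.
Proof.
have at_mid (e : edge (corona2 G)) :
    mid v \in val e -> inr e \in tip v \/ inr e = stem v.
  by case/edge_at_mid => ->; [right | left; apply/tipP; constructor].
have at_leaf (e : edge (corona2 G)) :
    leaf v \in val e -> inr e \in tip v \/ inr e = stem v.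
  by move/edge_at_leaf=> ->; left; apply/tipP; constructor.
case/tipP=> ->; case: z => [x|e] //=; [exact: at_mid | exact: at_leaf | |].
  by rewrite in_set2 => /orP[]/eqP->; left; apply/tipP; constructor.
case/andP=> _ /set0Pn[x]; rewrite in_setI in_set2 => /andP[/orP[]/eqP-> xe].
  exact: at_mid.
exact: at_leaf.
Qed.

(** Dominating the three vertices of the pendant path at [v] provides charges
2, 2 and 1. A single element dominates two of these vertices when it is
[stem v] or [twig v]. If it is [stem v], or if it is [twig v] and [leaf v] is
missing from [S], the complement of [S] is cut by [S] at [v], and its
connectedness gives the missing charge or the left alternative. *)
Lemma load_ge5 S v : dominating S -> connected (delete_vertices S) ->
  ~: S \subset tip v \/ 5 <= load S v.
Proof.
move=> domS connS; have [stemS|stemNS] := boolP (stem v \in S).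
  (* Now [S] contains the only exit of [tip v]. *)
  have [/subsetP tipS|/subsetPn[x xtip xS]] := boolP (tip v \subset S); last first.
    left; apply: (delete_vertices_sub connS xtip xS) => y z ytip yz zS.
    case: (tip_neighbor ytip yz) => // zstem.
    by rewrite zstem stemS in zS.
  right; have := @load_ge S v [:: stem v; inl (mid v); inl (leaf v)].
  rewrite /= !inE /eq_op /= ?levels_neq => /(_ isT).
  rewrite !big_cons big_nil charge_block_edge // /charge /= eqxx.
  move=> le6; apply: leq_trans (le6 _) => //; apply/allP.
  by rewrite /= stemS !tipS // !inE eqxx ?orbT.
have [leafS|leafNS] := boolP (inl (leaf v) \in S); last first.
  (* [twig v] has to dominate [leaf v], which it then isolates from the rest of
     the complement of [S]. *)
  left; apply: subset_trans (_ : [set inl (leaf v)] \subset tip v); last first.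
    by rewrite sub1set !inE eqxx orbT.
  apply: (delete_vertices_sub connS (set11 _) leafNS) => // y z /set1P-> lz zS.
  case: (dominating_vertex (leaf v) domS) => [lS|[e eS le]].
    by rewrite lS in leafNS.
  case: z lz zS => [//|f] lf fS.
  by rewrite (edge_at_leaf lf) -(edge_at_leaf le) eS in fS.
right.
have [x xS x_mid] : exists2 x, x \in S & x = inl (mid v) \/ x = twig v.
  case: (dominating_vertex (mid v) domS) => [mS|[e eS me]].
    by exists (inl (mid v)); [|left].
  case: (edge_at_mid me) eS => -> eS; first by rewrite eS in stemNS.
  by exists (twig v); [|right].
have x_charge : charge x v = 2.
  by case: x_mid => ->; [rewrite /= eqxx | exact: charge_block_edge].
have xl : inl (leaf v) != x by case: x_mid => ->; apply/eqP => // -[].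
(* [root v] is dominated by itself, by a stem, which is excluded here, or by an
   edge of [G] at [v]; only the last may give as little as 1. The edge differs
   from [x] because [twig v] does not contain [root v]. *)
have [z zS [z_charge xz lz]] : exists2 z, z \in S &
    [/\ 0 < charge z v, x != z & inl (leaf v) != z].
  case: (dominating_vertex (root v) domS) => [rS|[e eS re]].
    exists (inl (root v)) => //; split; first by rewrite /= eqxx.
      by case: x_mid => ->; apply/eqP => // -[].
    by apply/eqP => -[].
  exists (inr e) => //; split; [exact: charge_root_edge| |by apply/eqP].
  case: x_mid => ->; apply/eqP => // -[ee].
  by move: re; rewrite -ee /= in_set2 !levels_neq.
have := @load_ge S v [:: inl (leaf v); x; z].
rewrite !big_cons big_nil x_charge [charge (inl _) _]charge_vertex => le_load.
apply: leq_trans (le_load _ _); first by lia.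
  by rewrite /= !inE negb_or xl xz lz.
by apply/allP; rewrite /= leafS xS zS.
Qed.

(** Off [v] the three vertices of each pendant path are in [S], for a charge of
6; at [v] there remain [root v] and [stem v], for a charge of 4. *)
Lemma card_ge_tip S v : ~: S \subset tip v -> 6 * #|G| <= 2 * #|S| + 2.
Proof.
move/subsetP=> Stip.
have inS m : m \notin tip v -> m \in S.
  by apply: contraR => mS; apply: Stip; rewrite inE.
have load_v : 4 <= load S v.
  have := @load_ge S v [:: inl (root v); stem v] isT.
  rewrite !big_cons big_nil charge_block_edge // /charge /= eqxx.
  move=> le4; apply: leq_trans (le4 _) => //; apply/allP.
  rewrite /= !inS //; apply/tipP => -[] // -[].
  by move/setP/(_ (root v)); rewrite !in_set2 eqxx !levels_neq.
have load_u u : u != v -> 6 <= load S u.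
  move=> uv; apply: load_vertices; apply: inS;
    by apply/tipP => -[] // [] => [/eqP]; rewrite ?(negPf uv).
rewrite -sum_load (bigD1 v) //=.
have : \sum_(u | u != v) 6 <= \sum_(u | u != v) load S u by apply: leq_sum.
have := cardC1 v; rewrite sum_nat_const.
by set c := #|_|; set d := #|_|; lia.
Qed.

Lemma card_ge_load5 S :
  (forall v, 5 <= load S v) -> 2 * #|G| + uphalf #|G| <= #|S|.
Proof.
move=> load5; have : \sum_(v : G) 5 <= \sum_v load S v by exact: leq_sum.
rewrite sum_load sum_nat_const; change #|xpredT| with #|G|; lia.
Qed.

Lemma outer_connected_dominating_ge S :
  1 < #|G| -> outer_connected_dominating S -> 2 * #|G| + uphalf #|G| <= #|S|.
Proof.
move=> G_gt1 /andP[domS connS].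
have [/existsP[v /card_ge_tip]|noTip] := boolP [exists v, ~: S \subset tip v].
  by lia.
apply: card_ge_load5 => v; case: (load_ge5 v domS connS) => // Stip.
by case/existsP: noTip; exists v.
Qed.

End Corona.

Theorem theorem5p4 (G : sgraph) (n : nat) (order_G : #|G| = n)
    (n_ge2 : 2 <= n) (connected_G : connected G) :
  2 * n + uphalf n
    <= outer_connected_domination_number (middle_graph (corona2 G))
    <= 3 * n.
Proof.
have order_H : #|corona2 G| = 3 * n by rewrite card_prod card_ord order_G mulnC.
apply/andP; split; last first.
  rewrite -order_H; apply: outer_connected_domination_middle_le.
    exact: connected_corona2.
  by rewrite order_H; lia.
subst n; apply: leq_bigminn => [|S]; last exact: outer_connected_dominating_ge.
(* The default value of the minimum is the size of the set of all vertices. *)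
rewrite -(cardsT (middle_graph _)); apply: card_ge_load5 => v.
apply: leq_trans (_ : 6 <= _) => //.
by apply: load_vertices; rewrite inE.
Qed.
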